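(* Let $d\ge 1$ be an integer and let $f\in\mathbb{R}[x,y]$ be a nonzero homogeneous polynomial of degree $d$ in two variables. Then the number of real eigenvectors of $f$ is greater than or equal to the number of real roots of $f$.
   Context: A real eigenvector of a homogeneous polynomial $f\in\mathbb{R}[x,y]$ is a nonzero vector $v\in\mathbb{R}^2$ such that $\nabla f(v)=\lambda v$ for some $\lambda\in\mathbb{R}$ ($\lambda=0$ is allowed); equivalently, $v$ is a nonzero real zero of $y f_x - x f_y$. Eigenvectors are counted up to nonzero real scalar multiples, i.e. as points of $\mathbb{P}^1(\mathbb{R})$ (their number may be infinite). The real roots of $f$ are the points of $\mathbb{P}^1(\mathbb{R})$ at which $f$ vanishes. *)

(* Defs.v *)
From HB Require Import structures.
From mathcomp Require Import all_boot all_order all_algebra.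
From mathcomp Require Import mpoly.
From mathcomp Require Import boolp classical_sets functions cardinality reals.

Set Implicit Arguments.
Unset Strict Implicit.
Unset Printing Implicit Defensive.

Import GRing.Theory.

Local Open Scope classical_set_scope.
Local Open Scope ring_scope.

Section BinaryForms.
Variable R : realType.
Implicit Types (f : {mpoly R[2]}) (v : 'rV[R]_2).

(* v 0 is the coordinate function 'I_2 -> R of the row vector v. *)
Definition gradient f v : 'rV[R]_2 := \row_i f^`M(i).@[v 0].

Definition eigenvector f v : Prop :=
  v != 0 /\ exists lambda : R, gradient f v = lambda *: v.

(* P^1(R) is the set of lines of R^2: nonzero v, w give the same point <[v]> =
   <[w]> exactly when they are nonzero scalar multiples of each other. *)
Definition eigenpoints f : set {vspace 'rV[R]_2} :=
  [set <[v]>%VS | v in [set v | eigenvector f v]].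

(* For homogeneous f, vanishing at v depends only on the point <[v]>. *)
Definition real_roots f : set {vspace 'rV[R]_2} :=
  [set <[v]>%VS | v in [set v : 'rV[R]_2 | v != 0 /\ f.@[v 0] = 0]].

End BinaryForms.

(* Main.v *)
Require Import Defs.
From HB Require Import structures.
From mathcomp Require Import all_boot all_order all_algebra.
From mathcomp Require Import mpoly.
From mathcomp Require Import boolp classical_sets functions cardinality reals.
From mathcomp Require Import polyrcf ring lra.

(** The restriction of [f] to the unit circle has tangential derivative
[x f_y - y f_x], so by Rolle's theorem some eigenvector direction lies strictly
between any two consecutive root directions.  Sending each root line to such an
eigenvector line, found on the arc that runs counterclockwise from it to the
next root line (possibly itself, after half a turn), is injective, because the
root is recovered from the eigenvector: it is the last root line met before it.

No enumeration of the roots is needed.  The relation between a root [v] and the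
eigenvector [w] chosen for it is [rootfree_arc f v w]: [f] has no zero strictly
after [v] up to and including [w].  Then [exists_eigenvector_after_root] says
that every root is related to some eigenvector line, and [rootfree_arc_inj]
that an eigenvector line is related to at most one root line.  This gives a map
from eigenvector lines whose image contains all root lines.

To remain with polynomials, the half circle from [v] to [- v] is replaced by the
parabola [halfturn v], [s |-> - s v + (1 - s^2) J v] for [-1 <= s <= 1], where
[J] is the quarter turn.  It is not of constant norm, so Rolle's theorem would be
applied to [P / N^(d/2)], with [P] the pullback of [f] and [N] the squared norm;
the numerator of its derivative is, up to a constant, [N P' - (N' d / 2) P].
That this polynomial has a zero between consecutive zeros of [P] is
[rolle_twisted], and by Euler's identity and the chain rule such a zero is a
zero of [x f_y - y f_x]. *)

Set Implicit Arguments.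
Unset Strict Implicit.
Unset Printing Implicit Defensive.

Import Order.TTheory GRing.Theory Num.Theory.
Local Open Scope classical_set_scope.
Local Open Scope ring_scope.

(** * Rolle's theorem for a first-order operator *)

(** Near a zero of [p] of multiplicity [k], [p'] behaves like [k p / (x - a)] and
dominates [r p], so [N p' - r p] has just after [a] the sign of [p], and just
before [b] the opposite one.  Dividing out the powers of ['X - a] and ['X - b]
turns this into a strict sign change of the cofactor [B] on [[a, b]]. *)
Lemma rolle_twisted (R : rcfType) (p N r : {poly R}) (a b : R) :
  a < b -> p.[a] = 0 -> p.[b] = 0 -> p != 0 ->
  {in `]a, b[, forall x, ~~ root p x} -> 0 < N.[a] -> 0 < N.[b] ->
  exists2 c, c \in `]a, b[ & root (N * p^`() - r * p) c.
Proof.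
move=> lt_ab pa pb p0 nr Na Nb.
have [m [q]] := multiplicity_XsubC p a.
rewrite p0 /= => qa pE.
have q0 : q != 0 by apply: contraNneq p0 => q0; rewrite pE q0 mul0r.
have [n [h]] := multiplicity_XsubC q b.
rewrite q0 /= => hb qE.
have ha : ~~ root h a.
  by apply: contra qa; rewrite qE rootM => ->.
case: m => [|m] in pE *.
  by move: qa; rewrite /root -pa pE expr0 mulr1 eqxx.
case: n => [|n] in qE *.
  have : q.[b] * ('X - a%:P).[b] ^+ m.+1 = 0 by rewrite -pb pE hornerM horner_exp.
  move/eqP; rewrite mulf_eq0 expf_eq0 /= hornerXsubC subr_eq0 (gt_eqF lt_ab) orbF.
  by move=> /eqP qb; move: hb; rewrite /root -qb qE expr0 mulr1 eqxx.
(* A sign change of h on [a, b] would give p a zero inside. *)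
have hab : 0 < h.[a] * h.[b].
  rewrite ltNge; apply/negP => hab.
  have [c cab hc] := polyrcf.poly_ivt (ltW lt_ab) hab.
  have ca : c != a by apply: contraNneq ha => <-.
  have cb : c != b by apply: contraNneq hb => <-.
  have /nr/negP[] : c \in `]a, b[.
    by move: cab; rewrite !in_itv /= !lt_neqAle cb [a == c]eq_sym ca /= => /andP[-> ->].
  by rewrite pE qE !rootM hc.
pose B := N * (m.+1%:R * h * ('X - b%:P) + n.+1%:R * h * ('X - a%:P)
                + h^`() * ('X - a%:P) * ('X - b%:P))
          - r * (h * ('X - a%:P) * ('X - b%:P)).
have BE : N * p^`() - r * p = B * ('X - a%:P) ^+ m * ('X - b%:P) ^+ n.
  rewrite pE qE !derivM !deriv_exp !derivXsubC !mul1r /B /= !exprS.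
  rewrite -[_ *+ m.+1]mulr_natr -[_ *+ n.+1]mulr_natr.
  by move: m.+1%:R n.+1%:R => k l; ring.
have Bab : B.[a] * B.[b] < 0.
  have -> : B.[a] = N.[a] * h.[a] * (a - b) * m.+1%:R.
    by rewrite /B !(hornerD, hornerN, hornerM, hornerX, hornerMn, hornerC); ring.
  have -> : B.[b] = N.[b] * h.[b] * (b - a) * n.+1%:R.
    by rewrite /B !(hornerD, hornerN, hornerM, hornerX, hornerMn, hornerC); ring.
  have -> : N.[a] * h.[a] * (a - b) * m.+1%:R * (N.[b] * h.[b] * (b - a) * n.+1%:R) =
    - (N.[a] * N.[b] * (h.[a] * h.[b]) * (b - a) ^+ 2 * (m.+1%:R * n.+1%:R)) by ring.
  have k0 : 0 < m.+1%:R * n.+1%:R :> R by rewrite mulr_gt0 ?ltr0Sn.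
  rewrite oppr_lt0 (mulr_gt0 _ k0) // mulr_gt0 ?exprn_gt0 ?subr_gt0 //.
  exact: mulr_gt0 (mulr_gt0 Na Nb) hab.
have [c cab Bc] := polyrcf.poly_ivtoo (ltW lt_ab) Bab.
by exists c => //; rewrite BE !rootM Bc.
Qed.

(** * Evaluation and derivatives of multivariate polynomials *)

Lemma big_ord2 (V : nmodType) (F : 'I_2 -> V) : \sum_i F i = F 0 + F 1.
Proof. by rewrite !big_ord_recl big_ord0 addr0; congr (_ + F _); apply: val_inj. Qed.

Section Mmap.
Variables (R : comNzRingType) (n : nat).
Implicit Types (f g : {mpoly R[n]}) (h : 'I_n -> {poly R}).

Lemma horner_mmap h f s :
  (mmap polyC h f).[s] = f.@[fun i => (h i).[s]].
Proof.
rewrite mevalE /mmap horner_sum; apply: eq_bigr => m _.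
rewrite hornerM hornerC /mmap1 horner_prod; congr (_ * _).
by apply: eq_bigr => i _; rewrite horner_exp.
Qed.

Lemma mpoly_ring_ind (P : {mpoly R[n]} -> Prop) :
  (forall c, P c%:MP) -> (forall i, P 'X_i) ->
  (forall f g, P f -> P g -> P (f + g)) ->
  (forall f g, P f -> P g -> P (f * g)) -> forall f, P f.
Proof.
move=> PC PX PD PM f; rewrite [f]mpolyE.
apply: (big_ind P) => [||m _]; [exact: (PC 0) | exact: PD |].
rewrite -mul_mpolyC mpolyXE_id; apply: (PM) => //.
apply: (big_ind P) => [||i _]; [exact: (PC 1) | exact: (PM) |].
by elim: (m i) => [|k IH]; [exact: (PC 1) | rewrite exprS; exact: PM].
Qed.

(** The chain rule along the polynomial curve [h]. *)
Lemma deriv_mmap h f :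
  (mmap polyC h f)^`() = \sum_i mmap polyC h f^`M(i) * (h i)^`().
Proof.
elim/mpoly_ring_ind: f => [c|j|f g IHf IHg|f g IHf IHg].
- rewrite mmapC derivC big1 // => i _; by rewrite mderivC mmap0 mul0r.
- rewrite mmapX mmap1U (bigD1 j) //= big1 => [|i ij].
    by rewrite addr0 mderivX mnm1E eqxx scale1r -{1}[U_(j)%MM]add0m addmK mpolyX0 rmorph1 mul1r.
  by rewrite mderivX mnm1E eq_sym (negPf ij) scale0r mmap0 mul0r.
- rewrite mmapD derivD IHf IHg -big_split; apply: eq_bigr => i _ /=.
  by rewrite mderivD mmapD mulrDl.
- rewrite rmorphM derivM IHf IHg mulr_suml mulr_sumr -big_split.
  apply: eq_bigr => i _ /=.
  by rewrite mderivM mmapD !rmorphM /=; ring.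
Qed.

Lemma meval_dhomogZ (d : nat) f (k : R) (x : 'I_n -> R) :
  f \is d.-homog -> f.@[fun i => k * x i] = k ^+ d * f.@[x].
Proof.
move=> /dhomogP hf; rewrite !mevalE mulr_sumr !big_seq; apply: eq_bigr => m mf.
rewrite mulrCA -(hf m mf); congr (_ * _).
under eq_bigr do rewrite exprMn.
by rewrite big_split /= prodrXr mdegE.
Qed.

(** Differentiate [f (t x) = t^d f x] at [t = 1]. *)
Lemma euler_dhomog (d : nat) f (x : 'I_n -> R) :
  f \is d.-homog -> \sum_i f^`M(i).@[x] * x i = d%:R * f.@[x].
Proof.
move=> hf.
have pE : mmap polyC (fun i => x i *: 'X) f = f.@[x] *: 'X^d.
  rewrite /mmap mevalE scaler_suml !big_seq; apply: eq_bigr => m mf.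
  rewrite /mmap1 /=; under eq_bigr => i _ do rewrite exprZn.
  rewrite scaler_prod prodrXr -mdegE (dhomog_mf hf mf).
  by rewrite -scalerA mul_polyC.
have := congr1 (fun p : {poly R} => p^`().[1]) pE.
rewrite /= deriv_mmap derivZ derivXn horner_sum hornerZ hornerMn hornerXn expr1n.
rewrite [f.@[x] * _]mulrC => <-; apply: eq_bigr => i _.
rewrite hornerM horner_mmap derivZ derivX hornerZ hornerC mulr1; congr (_ * _).
by apply: meval_eq => j; rewrite hornerZ hornerX mulr1.
Qed.

End Mmap.

(** In a form of degree [d], the exponent of one variable determines the other,
so setting the second variable to [1] merges no two monomials. *)
Lemma dehomogenize_neq0 (R : comNzRingType) (d : nat) (f : {mpoly R[2]}) :
  f != 0 -> f \is d.-homog ->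
  mmap polyC (fun i : 'I_2 => if i == 0 then 'X else 1) f != 0.
Proof.
move=> f0 hf; set h := fun i : 'I_2 => _.
apply/eqP => p0.
have [m mf] : exists m, m \in msupp f.
  have : msupp f != [::] by rewrite msupp_eq0.
  by case: (msupp f) => // m s _; exists m; rewrite inE eqxx.
have := congr1 (fun p : {poly R} => p`_(m 0)) p0; rewrite coef0 /mmap coef_sum.
have dE m' : m' \in msupp f -> (m' 0%R + m' 1%R)%N = d.
  by move=> /(dhomog_mf hf) /= <-; rewrite mdegE !big_ord_recl big_ord0 addn0;
    congr (_ + m' _)%N; apply: val_inj.
rewrite (bigD1_seq m) ?msupp_uniq //= big_seq_cond big1 => [|m' /andP[m'f m'm]].
  rewrite /mmap1 !big_ord_recl big_ord0 /h /= mulr1 expr1n mulr1 mul_polyC.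
  rewrite coefZ coefXn eqxx mulr1 addr0 => /eqP; rewrite -[_ == 0]negbK -mcoeff_msupp.
  by rewrite mf.
rewrite /mmap1 !big_ord_recl big_ord0 /h /= mulr1 expr1n mulr1 mul_polyC.
rewrite coefZ coefXn; case: eqP => [m0|]; last by rewrite mulr0.
case/eqP: m'm; apply/mnmP => i.
have m1 : m' 1 = m 1 by apply/eqP; rewrite -(eqn_add2l (m' 0)) dE // -m0 dE.
by case: i => [[|[|//]] lti]; [move: m0 => /esym | move: m1];
  congr (_ = _); congr (_ _); apply: val_inj.
Qed.

(** * Oriented geometry of the plane *)

Section Plane.
Variable R : rcfType.
Implicit Types (f : {mpoly R[2]}) (v w x : 'rV[R]_2).

(** Positive exactly when the angle from [v] to [w], counterclockwise, lies
strictly between zero and half a turn. *)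
Definition cross v w : R := v 0 0 * w 0 1 - v 0 1 * w 0 0.

Lemma crossN v w : cross v w = - cross w v.
Proof. by rewrite /cross; ring. Qed.

Lemma crossZl k v w : cross (k *: v) w = k * cross v w.
Proof. by rewrite /cross !mxE; ring. Qed.

Lemma crossZr k v w : cross v (k *: w) = k * cross v w.
Proof. by rewrite /cross !mxE; ring. Qed.

Lemma cross_gt0_neq0 v w : 0 < cross v w -> v != 0 /\ w != 0.
Proof.
by move=> vw; split; apply: contraTneq vw => ->;
  rewrite /cross !mxE ?(mul0r, mulr0) subrr ltxx.
Qed.

Definition normsq v : R := v 0 0 ^+ 2 + v 0 1 ^+ 2.

Lemma rV2P v w : v 0 0 = w 0 0 -> v 0 1 = w 0 1 -> v = w.
Proof.
move=> v0 v1; apply/rowP => i.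
by case: i => [[|[|//]] lti]; [move: v0 | move: v1];
  congr (_ = _); congr (_ _ _); apply: val_inj.
Qed.

Lemma normsq_gt0 v : (0 < normsq v) = (v != 0).
Proof.
rewrite lt_neqAle addr_ge0 ?sqr_ge0 // andbT eq_sym paddr_eq0 ?sqr_ge0 //.
rewrite !sqrf_eq0; congr (~~ _); apply/andP/eqP => [[/eqP v0 /eqP v1]|->].
  by apply: rV2P; rewrite mxE.
by rewrite !mxE.
Qed.

Lemma line_eqP v w : v != 0 -> w != 0 ->
  reflect (exists2 k, k != 0 & w = k *: v) (<[v]> == <[w]>)%VS.
Proof.
move=> v0 w0; apply: (iffP eqP) => [vw|[k k0 ->]].
  have /vlineP[k wE] : w \in <[v]>%VS by rewrite vw memv_line.
  by exists k => //; apply: contraNneq w0 => k0; rewrite wE k0 scale0r.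
apply/eqP; rewrite eqEsubv; apply/andP; split; rewrite -memvE; last first.
  by rewrite memvZ ?memv_line.
by rewrite -[X in X \in _](scalerK k0) memvZ ?memv_line.
Qed.

Lemma cross_eq0 v w : v != 0 -> w != 0 -> cross v w = 0 -> (<[v]> = <[w]>)%VS.
Proof.
move=> v0 w0 vw; have nv : normsq v != 0 by rewrite gt_eqF ?normsq_gt0.
have wE : w = ((v 0 0 * w 0 0 + v 0 1 * w 0 1) / normsq v) *: v.
  apply: rV2P; rewrite mxE mulrAC; apply: (mulIf nv); rewrite mulfVK //.
    by apply/eqP; rewrite -subr_eq0 -(mulr0 (- v 0 1)) -vw /normsq /cross; apply/eqP; ring.
  by apply/eqP; rewrite -subr_eq0 -(mulr0 (v 0 0)) -vw /normsq /cross; apply/eqP; ring.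
apply/eqP/line_eqP => //; exists ((v 0 0 * w 0 0 + v 0 1 * w 0 1) / normsq v) => //.
by apply: contraNneq w0 => k0; rewrite wE k0 scale0r.
Qed.

(** * Arcs without roots *)

(** For [w] less than half a turn after [v], the two inequalities on [x] describe
the open-closed sector from [v] to [w]. *)
Definition rootfree_arc f v w :=
  0 < cross v w /\
  forall x, 0 < cross v x -> 0 <= cross x w -> f.@[x 0] != 0.

Lemma mevalZrow d f (k : R) x : f \is d.-homog ->
  f.@[(k *: x) 0] = k ^+ d * f.@[x 0].
Proof.
by move=> /meval_dhomogZ <-; apply: meval_eq => i; rewrite mxE.
Qed.

(** The factor moves from [w] to [v], also when it is negative: this lets two
generators of one eigenvector line be replaced by the same vector. *)
Lemma rootfree_arcZ d f k v w : f \is d.-homog -> k != 0 ->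
  rootfree_arc f v (k *: w) -> rootfree_arc f (k *: v) w.
Proof.
move=> hf k0 [vw arc]; split=> [|x vx xw]; first by rewrite crossZl -crossZr.
have := arc (k *: x); rewrite (mevalZrow _ _ hf) mulf_eq0 expf_eq0 (negPf k0).
rewrite andbF /=; apply; first by rewrite crossZr -crossZl.
by rewrite crossZl crossZr mulrA -expr2 mulr_ge0 ?sqr_ge0.
Qed.

(** Two root-free arcs that end at the same [w] start on the same line: otherwise
one of the starting points lies in the sector of the other. *)
Lemma rootfree_arc_inj d f v1 v2 w1 w2 : f \is d.-homog ->
  f.@[v1 0] = 0 -> f.@[v2 0] = 0 ->
  rootfree_arc f v1 w1 -> rootfree_arc f v2 w2 ->
  (<[w1]> = <[w2]>)%VS -> (<[v1]> = <[v2]>)%VS.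
Proof.
move=> hf fv1 fv2 [v1w1 arc1] arc2.
have [v10 w10] := cross_gt0_neq0 v1w1.
have [v20 w20] := cross_gt0_neq0 (proj1 arc2).
move=> /eqP/line_eqP[] // k k0 w2E.
have {arc2} [kv2w1 arc2] : rootfree_arc f (k *: v2) w1.
  by apply: (rootfree_arcZ hf k0); rewrite -w2E.
transitivity <[k *: v2]>%VS; last first.
  by apply/esym/eqP/line_eqP; rewrite ?scaler_eq0 ?negb_or ?k0 //; exists k.
apply: cross_eq0 => //; first by rewrite scaler_eq0 negb_or k0.
apply/eqP; rewrite eq_le !leNgt; apply/andP; split; apply/negP => cr.
  by have := arc1 _ cr (ltW kv2w1); rewrite (mevalZrow _ _ hf) fv2 mulr0 eqxx.
by have := arc2 v1; rewrite crossN oppr_gt0 cr fv1 eqxx => /(_ isT (ltW v1w1)).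
Qed.

(** A nonzero form does not vanish on a whole open half plane.  On the line
[x_1 = 1] it is a nonzero polynomial in [x_0], hence nonzero somewhere off the
line of [v]; a sign brings this point to the required side. *)
Lemma dhomog_nonroot d f v : f != 0 -> f \is d.-homog -> v != 0 ->
  exists2 x, 0 < cross v x & f.@[x 0] != 0.
Proof.
move=> f0 hf v0.
pose h (i : 'I_2) : {poly R} := if i == 0 then 'X else 1.
have p0 : mmap polyC h f != 0 := dehomogenize_neq0 f0 hf.
pose q : {poly R} := (v 0 0)%:P - v 0 1 *: 'X.
have q0 : q != 0.
  apply: contraNneq v0 => q0; apply/eqP/rV2P; rewrite mxE.
    by have := congr1 (fun p : {poly R} => p`_0) q0; rewrite !coefE /= mulr0 subr0.
  by have := congr1 (fun p : {poly R} => p`_1) q0; rewrite !coefE /= mulr1 sub0r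
    => /eqP; rewrite oppr_eq0 => /eqP.
have [t tr] : exists t, ~~ root (mmap polyC h f * q) t.
  exists (cauchy_bound (mmap polyC h f * q)); apply/negP => rt.
  have := cauchy_boundP (mulf_neq0 p0 q0) (eqP rt).
  by rewrite ltNge ler_norm.
pose x : 'rV[R]_2 := \row_i (h i).[t].
have fx : f.@[x 0] != 0.
  move: tr; rewrite rootM negb_or /root => /andP[+ _]; rewrite horner_mmap.
  by rewrite (@meval_eq _ _ _ (x 0)) // => i; rewrite mxE.
have vx : cross v x != 0.
  move: tr; rewrite rootM negb_or /root => /andP[_]; rewrite /cross !mxE /h /=.
  by rewrite !hornerE.
move: vx; rewrite neq_lt => /orP[vx|vx]; last by exists x.
exists (-1 *: x); first by rewrite crossZr mulN1r oppr_gt0.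
by rewrite (mevalZrow _ _ hf) mulf_neq0 // expf_neq0 // oppr_eq0 oner_eq0.
Qed.

(** * The parabola from a vector to its opposite *)

(** The coordinates of the curve [s |-> - s v + (1 - s^2) J v], with
[J (x, y) = (- y, x)]; it sweeps the open half plane counterclockwise of [v] as
[s] runs over []-1, 1[]. *)
Definition halfturn v (i : 'I_2) : {poly R} :=
  - (v 0 i *: 'X) + (if i == 0 then - v 0 1 else v 0 0) *: (1 - 'X^2).

Definition halfturn_at v s : 'rV[R]_2 := \row_i (halfturn v i).[s].

Lemma halfturn_at0 v s : halfturn_at v s 0 0 = - s * v 0 0 - (1 - s ^+ 2) * v 0 1.
Proof. by rewrite mxE /halfturn /= !hornerE; ring. Qed.

Lemma halfturn_at1 v s : halfturn_at v s 0 1 = - s * v 0 1 + (1 - s ^+ 2) * v 0 0.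
Proof. by rewrite mxE /halfturn /= !hornerE; ring. Qed.

Lemma cross_halfturn v s : cross v (halfturn_at v s) = (1 - s ^+ 2) * normsq v.
Proof. by rewrite /cross halfturn_at0 halfturn_at1 /normsq; ring. Qed.

Lemma normsq_halfturn v s :
  normsq (halfturn_at v s) = normsq v * ((s ^+ 2 - 2^-1) ^+ 2 + 3 / 4).
Proof. by rewrite /normsq halfturn_at0 halfturn_at1; field. Qed.

(** Positivity of this determinant says that the curve turns counterclockwise. *)
Lemma cross_deriv_halfturn v s :
  halfturn_at v s 0 0 * (halfturn v 1)^`().[s]
    - halfturn_at v s 0 1 * (halfturn v 0)^`().[s] = normsq v * (1 + s ^+ 2).
Proof.
have du i : (halfturn v i)^`().[s] =
    - v 0 i - (if i == 0 then - v 0 1 else v 0 0) * (2 * s).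
  by rewrite /halfturn !derivE ![in LHS]hornerE; ring.
by rewrite !du halfturn_at0 halfturn_at1 /normsq /=; ring.
Qed.

(** The cross product of [x] with the curve is negative at [-1], where the curve
is at [v], and nonnegative at [c]; at a zero in between the curve is on the ray
of [x]. *)
Lemma halfturn_onto v x c : -1 < c <= 1 -> 0 < cross v x ->
  0 <= cross x (halfturn_at v c) ->
  exists2 s, -1 < s <= c & exists2 k, 0 < k & x = k *: halfturn_at v s.
Proof.
move=> /andP[c_gtN1 c_le1] vx xc.
have [v0 _] := cross_gt0_neq0 vx.
have nv : 0 < normsq v by rewrite normsq_gt0.
(* g evaluates at s to the cross product of x with the curve at s. *)
pose a := v 0 0 * x 0 0 + v 0 1 * x 0 1.
pose g : {poly R} := a *: (1 - 'X^2) + cross v x *: 'X.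
have gE t : g.[t] = a * (1 - t ^+ 2) + cross v x * t by rewrite /g !hornerE.
have gc : 0 <= g.[c].
  have -> : g.[c] = cross x (halfturn_at v c).
    rewrite gE /a /cross halfturn_at0 halfturn_at1; ring.
  by [].
have gN1 : g.[-1] < 0.
  have -> : g.[-1] = - cross v x by rewrite gE; ring.
  by rewrite oppr_lt0.
have [s sc gs] := polyrcf.poly_ivt (ltW c_gtN1) (mulr_le0_ge0 (ltW gN1) gc).
move: sc; rewrite in_itv /= => /andP[sN1 sc].
have s_gt : -1 < s.
  rewrite lt_neqAle sN1 andbT; apply/eqP => sE.
  by move: gs; rewrite -sE /root (lt_eqF gN1).
have s_lt : s < 1.
  rewrite lt_neqAle (le_trans sc c_le1) andbT; apply/eqP => sE.
  by move: gs; rewrite sE /root gE expr1n subrr mulr0 add0r mulr1 (gt_eqF vx).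
exists s; first by rewrite s_gt.
have s2 : 0 < 1 - s ^+ 2 by nra.
exists (cross v x / (normsq v * (1 - s ^+ 2))).
  by rewrite divr_gt0 // mulr_gt0.
move/eqP: gs; rewrite gE => gs.
have D0 : normsq v * (1 - s ^+ 2) != 0 by rewrite gt_eqF ?mulr_gt0.
apply: rV2P; rewrite mxE mulrAC; apply: (mulIf D0); rewrite mulfVK //.
  apply/eqP; rewrite -subr_eq0 -(mulr0 (v 0 0)) -gs halfturn_at0 /a /normsq /cross.
  apply/eqP; ring.
apply/eqP; rewrite -subr_eq0 -(mulr0 (v 0 1)) -gs halfturn_at1 /a /normsq /cross.
apply/eqP; ring.
Qed.

End Plane.

(** * Eigenvectors between consecutive roots *)

Section Eigenvectors.
Variable R : realType.
Implicit Types (f : {mpoly R[2]}) (v w : 'rV[R]_2).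

Lemma eigenvector_cross0 f w :
  w != 0 -> cross w (gradient f w) = 0 -> eigenvector f w.
Proof.
move=> w0 wg; split=> //.
have [g0|g0] := eqVneq (gradient f w) 0; first by exists 0; rewrite g0 scale0r.
have /eqP/line_eqP[] // := cross_eq0 w0 g0 wg.
by move=> k _ ->; exists k.
Qed.

(** Let [b] be the first parameter after [-1] at which the curve from [v] meets a
root; [b <= 1] since [- v] is one.  A zero [c] of [N P' - r P] in []-1, b[] gives
the eigenvector, and the curve up to [c] stays clear of the roots. *)
Lemma exists_eigenvector_after_root d f v : f != 0 -> f \is d.-homog ->
  v != 0 -> f.@[v 0] = 0 ->
  exists2 w, eigenvector f w & rootfree_arc f v w.
Proof.
move=> f0 hf v0 fv.
have nv : 0 < normsq v by rewrite normsq_gt0.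
pose P := mmap polyC (halfturn v) f.
have PE s : P.[s] = f.@[halfturn_at v s 0].
  by rewrite horner_mmap; apply: meval_eq => i; rewrite mxE.
have halfturn1 : halfturn_at v 1 = -1 *: v.
  by apply: rV2P; rewrite ?halfturn_at0 ?halfturn_at1 mxE; ring.
have PN1 : P.[-1] = 0.
  rewrite PE (_ : halfturn_at v (-1) = v) //.
  by apply: rV2P; rewrite ?halfturn_at0 ?halfturn_at1; ring.
have P1 : P.[1] = 0.
  by rewrite PE halfturn1 (mevalZrow _ _ hf) fv mulr0.
have P0 : P != 0.
  have [x vx fx] := dhomog_nonroot f0 hf v0.
  have x1 : 0 <= cross x (halfturn_at v 1).
    by rewrite halfturn1 crossZr mulN1r -crossN ltW.
  have [|s _ [k k0 xE]] := halfturn_onto _ vx x1; first by rewrite lexx andbT; lra.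
  apply: contraNneq fx => P0.
  by rewrite xE (mevalZrow _ _ hf) -PE P0 horner0 mulr0.
have [b [b_gt b_le Pb nr]] : exists b, [/\ -1 < b, b <= 1, P.[b] = 0
    & {in `]-1, b[, forall s, ~~ root P s}].
  exists (next_root P (-1) 1); case: next_rootP => [P0'|y _ Py|c _ ->].
  - by rewrite P0' eqxx in P0.
  - by rewrite in_itv /= => /andP[y_gt y_lt] nr; split=> //; exact: ltW.
  - by rewrite max_l ?lerN1 => [nr|]; [split=> //; lra | lra].
pose u := halfturn v.
pose N : {poly R} := u 0 ^+ 2 + u 1 ^+ 2.
pose r : {poly R} := d%:R * (u 0 * (u 0)^`() + u 1 * (u 1)^`()).
have NE s : N.[s] = normsq (halfturn_at v s).
  by rewrite /normsq !mxE /N hornerD !horner_exp.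
have N_gt0 s : 0 < N.[s].
  by rewrite NE normsq_halfturn mulr_gt0 // ltr_wpDl ?sqr_ge0 //; lra.
have [c] := rolle_twisted r b_gt PN1 Pb P0 nr (N_gt0 _) (N_gt0 _).
rewrite in_itv /= => /andP[c_gt c_lt] /eqP rc.
set w := halfturn_at v c.
have w0 : w != 0 by rewrite -normsq_gt0 -NE.
have vw : 0 < cross v w.
  by rewrite cross_halfturn mulr_gt0 //; nra.
exists w; last first.
  split=> // x vx xw.
  have [|s /andP[s_gt s_le] [k k0 ->]] := halfturn_onto _ vx xw.
    by rewrite c_gt ltW // (lt_le_trans c_lt).
  have kd : k ^+ d != 0 by rewrite expf_neq0 ?gt_eqF.
  rewrite (mevalZrow _ _ hf) (mulf_neq0 kd) // -PE.
  by have := nr s; rewrite in_itv /= s_gt (le_lt_trans s_le c_lt) => /(_ isT).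
apply: eigenvector_cross0 => //.
have wE i : w 0 i = (u i).[c] by rewrite mxE.
pose e i := f^`M(i).@[w 0].
have dP : P^`().[c] = e 0 * (u 0)^`().[c] + e 1 * (u 1)^`().[c].
  rewrite deriv_mmap horner_sum big_ord2 !hornerM !horner_mmap.
  by congr (_ * _ + _ * _); apply: meval_eq => i; rewrite wE.
have eu : d%:R * P.[c] = e 0 * w 0 0 + e 1 * w 0 1.
  by rewrite PE -(euler_dhomog _ hf) big_ord2.
have det0 : w 0 0 * (u 1)^`().[c] - w 0 1 * (u 0)^`().[c] != 0.
  by rewrite cross_deriv_halfturn gt_eqF ?mulr_gt0 // ltr_pwDl ?sqr_ge0.
have rE : r.[c] = d%:R * (w 0 0 * (u 0)^`().[c] + w 0 1 * (u 1)^`().[c]).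
  by rewrite /r hornerM hornerMn hornerD !hornerM -!wE hornerC.
(* With u the curve, Lagrange's identity in the plane reads
   |u|^2 (grad . u') - (u . u') (grad . u) = cross u u' * cross u grad. *)
apply: (mulfI det0); rewrite mulr0 -rc.
rewrite hornerD hornerN [(N * _).[c]]hornerM [(r * _).[c]]hornerM NE dP rE.
rewrite mulrAC eu /cross /normsq !mxE -/(e 0) -/(e 1).
move: (e 0) (e 1) => e0 e1; ring.
Qed.

End Eigenvectors.

Theorem theorem1 (R : realType) (d : nat) (f : {mpoly R[2]})
    (d_ge1 : (1 <= d)%N) (f_neq0 : f != 0) (f_homog : f \is d.-homog) :
  (real_roots f #<= eigenpoints f)%card.
Proof.
pose before M L := exists v w : 'rV[R]_2,
  [/\ L = <[v]>%VS, M = <[w]>%VS, f.@[v 0] = 0 & rootfree_arc f v w].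
pose lastroot M := xget 0%VS [set L | before M L].
apply: (@card_le_trans _ _ _ (lastroot @` eigenpoints f)); last exact: card_image_le.
apply: subset_card_le => _ [v [v0 fv] <-].
have [w ew arc] := exists_eigenvector_after_root f_neq0 f_homog v0 fv.
exists <[w]>%VS; first by exists w.
have bvw : before <[w]>%VS <[v]>%VS by exists v, w; split.
have [v1 [w1 [-> ww1 fv1 arc1]]] : before <[w]>%VS (lastroot <[w]>%VS).
  exact: (@xgetI _ _ [set L | before _ L] _ bvw).
exact: (rootfree_arc_inj f_homog fv1 fv arc1 arc).
Qed.
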